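(* Let $M$ be a matroid with ground set $E$, let $\psi\colon E\to\Gamma$ be a map to an abelian group $\Gamma$, and let $F\subseteq\Gamma$ be a finite set with $|F|\le 4$. Suppose $M$ has at least one $F$-avoiding basis. Then for every basis $A$ of $M$ there exists an $F$-avoiding basis $B$ of $M$ with $|A\setminus B|\le |F|$.
   Context: For $X\subseteq E$, $\psi(X)\coloneqq\sum_{e\in X}\psi(e)$; $X$ is $F$-avoiding if $\psi(X)\notin F$. *)

(* Defs.v *)
From mathcomp Require Export all_boot all_algebra finmap.

Set Implicit Arguments.
Unset Strict Implicit.
Unset Printing Implicit Defensive.

Record matroid (E : finType) := Matroid {
  indep : pred {set E};
  indep0 : indep set0;
  indepS : forall I J : {set E}, I \subset J -> indep J -> indep I;
  indep_aug : forall I J : {set E}, indep I -> indep J -> #|I| < #|J| ->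
    exists2 e : E, e \in J :\: I & indep (e |: I)
}.

Definition basis (E : finType) (M : matroid E) (B : {set E}) : bool :=
  maxset (indep M) B.

Definition label_sum (E : finType) (Gamma : zmodType) (psi : E -> Gamma)
  (X : {set E}) : Gamma := (\sum_(e in X) psi e)%R.

Definition avoiding (E : finType) (Gamma : zmodType) (psi : E -> Gamma)
  (F : {fset Gamma}) (X : {set E}) : bool := label_sum psi X \notin F.

(* Main.v *)
(** Choose an avoiding basis [B] with [#|A :\: B|] minimal.  By minimality, [B]
    is the only basis between [A :&: B] and [A :|: B] whose label lies outside
    [F].  So in the minor [N] obtained by deleting the elements outside
    [A :|: B] and contracting [A :&: B], the basis [B :\: A] is the only one
    with its label, and all labels but one come from [F]: it suffices to show
    that [N] has more than [d = #|A :\: B|] labels.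

    No element of [A :\: B] can replace an element of [B :\: A] with the same
    label, so the elements of each given label form an independent set of [N],
    and the ranks of these label classes add up to [2 d].  Now contract the
    elements [e] of [B :\: A] one at a time.  If a label class [g] spans [e],
    then [e] can be replaced by an element of label [g] in every basis
    containing it; so the labels contain the sum of the sets [W_e] of labels
    [g] spanning [e], and [sum_e #|W_e| = 2 d] since each contraction lowers
    the rank of exactly the spanning classes.  Because the label of [B] is
    attained by [B] only, it has a unique representation in this sum, and
    Scherk's theorem [#|X + Y| >= #|X| + #|Y| - 1] yields [2 d - (d - 1)]
    labels. *)

Require Import Defs.
From mathcomp Require Import zify.

Set Implicit Arguments.
Unset Strict Implicit.
Unset Printing Implicit Defensive.

Section Sumsets.

Variable Gamma : zmodType.
Implicit Types (X Y : {fset Gamma}) (a b x y z : Gamma).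

Import GRing.Theory.
Local Open Scope fset_scope.
Local Open Scope ring_scope.

Definition sumset X Y : {fset Gamma} := [fset x + y | x in X, y in Y].

Lemma sumsetP X Y z :
  reflect (exists2 x, x \in X & exists2 y, y \in Y & z = x + y)
    (z \in sumset X Y).
Proof. exact: imfset2P. Qed.

Lemma mem_sumset X Y x y : x \in X -> y \in Y -> x + y \in sumset X Y.
Proof. exact: in_imfset2. Qed.

Definition translate a X : {fset Gamma} := [fset a + x | x in X].

Lemma card_translate a X : #|` translate a X| = #|` X|.
Proof. by rewrite card_imfset //; exact: addrI. Qed.

Lemma translateP a X z :
  reflect (exists2 x, x \in X & z = a + x) (z \in translate a X).
Proof. exact: imfsetP. Qed.

Lemma translate_stable a X : translate a X `<=` X -> translate a X = X.
Proof. by move=> aX; apply/eqP; rewrite eqEfcard aX card_translate leqnn. Qed.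

Definition dyson_union a X Y : {fset Gamma} := X `|` translate a Y.

Definition dyson_inter a X Y : {fset Gamma} := [fset y in Y | a + y \in X].

Lemma dyson_unionP a X Y x :
  reflect (x \in X \/ exists2 y, y \in Y & x = a + y)
    (x \in dyson_union a X Y).
Proof.
rewrite inE; apply: (iffP orP) => -[xX|]; try by left.
  by move/translateP; right.
by move/(translateP a); right.
Qed.

Lemma in_dyson_inter a X Y y :
  (y \in dyson_inter a X Y) = (y \in Y) && (a + y \in X).
Proof. by rewrite !inE. Qed.

Lemma card_dyson a X Y :
  (#|` dyson_union a X Y| + #|` dyson_inter a X Y| = #|` X| + #|` Y|)%N.
Proof.
rewrite -[in RHS](card_translate a Y) -[in RHS]cardfsUI; congr (_ + _)%N.
rewrite -(card_translate a); congr #|` _|; apply/fsetP=> z; rewrite inE.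
apply/translateP/andP=> [[y]|[zX /translateP[y yY def_z]]].
  rewrite in_dyson_inter => /andP[yY ayX] ->; split=> //.
  by apply/translateP; exists y.
by exists y; rewrite // in_dyson_inter yY -def_z.
Qed.

Lemma sumset_dyson_sub a X Y :
  sumset (dyson_union a X Y) (dyson_inter a X Y) `<=` sumset X Y.
Proof.
apply/fsubsetP=> _ /sumsetP[x /dyson_unionP Xx [y + ->]].
rewrite in_dyson_inter => /andP[yY ayX].
case: Xx => [xX|[y' y'Y ->]]; first exact: mem_sumset.
by rewrite addrAC mem_sumset.
Qed.

Definition unique_sum X Y x0 y0 :=
  forall x y, x \in X -> y \in Y -> x + y = x0 + y0 -> y = y0.

Lemma unique_sum_dyson X Y x0 y0 a : a + y0 \in X -> unique_sum X Y x0 y0 ->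
  unique_sum (dyson_union a X Y) (dyson_inter a X Y) x0 y0.
Proof.
move=> ay0X uniq0 x y /dyson_unionP Xx; rewrite in_dyson_inter => /andP[yY ayX].
case: Xx => [xX|[y' y'Y ->]]; first exact: uniq0.
rewrite addrAC => sum0.
by apply: (uniq0 (a + y0)) => //; rewrite -sum0 (uniq0 _ _ ayX y'Y sum0) addrAC.
Qed.

Lemma dyson_shrinks X Y x0 y0 : x0 \in X -> y0 \in Y -> Y != [fset y0] ->
    unique_sum X Y x0 y0 ->
  exists2 a, a + y0 \in X & (#|` dyson_inter a X Y| < #|` Y|)%N.
Proof.
move=> x0X y0Y neqY uniq0.
have [b bY] : exists2 b, b \in Y & b \notin [fset y0].
  apply/fsubsetPn; rewrite fsubset1 negb_or neqY.
  by apply/fset0Pn; exists y0.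
rewrite inE => b_neq.
have /fsubsetPn[_ /translateP[x xX ->] bxX] :
    ~~ (translate (b - y0) X `<=` X).
  apply: contra b_neq => /translate_stable stableX.
  have /translateP[x xX def_x0] : x0 \in translate (b - y0) X.
    by rewrite stableX.
  by rewrite (uniq0 x b) // def_x0 addrAC subrK addrC.
exists (x - y0); first by rewrite subrK.
apply: fproper_ltn_card; rewrite fproperE; apply/andP; split.
  by apply/fsubsetP=> y; rewrite in_dyson_inter => /andP[].
apply/fsubsetPn; exists b; rewrite // in_dyson_inter negb_and.
by rewrite addrAC [x + b]addrC addrAC bxX orbT.
Qed.

Lemma Scherk_card_sumset X Y x0 y0 : x0 \in X -> y0 \in Y ->
    unique_sum X Y x0 y0 ->
  (#|` X| + #|` Y| <= (#|` sumset X Y|).+1)%N.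
Proof.
have [n] := ubnP #|` Y|; elim: n => // n IHn in X Y *.
rewrite ltnS => leYn x0X y0Y uniq0.
have [->|neqY] := eqVneq Y [fset y0].
  rewrite cardfs1 addn1 ltnS -(card_translate y0).
  apply/fsubset_leq_card/fsubsetP=> _ /translateP[x xX ->].
  by rewrite addrC mem_sumset ?inE.
have [a ay0X ltY] := dyson_shrinks x0X y0Y neqY uniq0.
rewrite -(card_dyson a); have := fsubset_leq_card (sumset_dyson_sub a X Y).
rewrite -ltnS; apply: leq_trans; apply: IHn.
- exact: leq_trans leYn.
- by apply/dyson_unionP; left.
- by rewrite in_dyson_inter y0Y.
- exact: unique_sum_dyson.
Qed.

End Sumsets.

Lemma cardsU_disjoint (T : finType) (X Y : {set T}) :
  [disjoint X & Y] -> #|X :|: Y| = #|X| + #|Y|.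
Proof. by move=> dXY; apply/eqP; rewrite (leq_card_setU X Y). Qed.

Lemma setDUK (T : finType) (X Y : {set T}) : X \subset Y -> Y :\: X :|: X = Y.
Proof. by move=> XY; rewrite setUC -{1}(setIidPr XY) setID. Qed.

Section Rank.

Variables (E : finType) (M : matroid E).
Implicit Types (I J X Y T B : {set E}) (e c : E).

Definition rank X := \max_(I : {set E} | (I \subset X) && indep M I) #|I|.

Lemma leq_rank I X : I \subset X -> indep M I -> #|I| <= rank X.
Proof. by move=> IX indI; apply: leq_bigmax_cond; rewrite IX. Qed.

Lemma rank_leq n X :
  (forall I, I \subset X -> indep M I -> #|I| <= n) -> rank X <= n.
Proof. by move=> le_n; apply/bigmax_leqP=> I /andP[]; exact: le_n. Qed.

Lemma rankS X Y : X \subset Y -> rank X <= rank Y.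
Proof.
move=> XY; apply: rank_leq => I IX; exact: leq_rank (subset_trans IX XY).
Qed.

Lemma indep_extend I X : indep M I -> I \subset X ->
  exists J, [/\ I \subset J, J \subset X, indep M J & #|J| = rank X].
Proof.
move=> indI IX.
have [|J maxJ IJ] :=
    @maxset_exists _ (fun J => (J \subset X) && indep M J) I.
  by rewrite IX.
have /andP[JX indJ] := maxsetp maxJ; exists J; split=> //.
apply/eqP; rewrite eqn_leq leq_rank //=; apply: rank_leq => K KX indK.
rewrite leqNgt; apply/negP=> /(indep_aug indJ indK)[e].
rewrite inE => /andP[/negP eJ eK] ind_eJ; case: eJ.
rewrite -(maxsetsup maxJ _ (subsetUr [set e] J)) ?setU11 //.
by rewrite ind_eJ subUset sub1set (subsetP KX) // JX.
Qed.

Lemma basisE B : basis M B = indep M B && (#|B| == rank [set: E]).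
Proof.
apply/maxsetP/andP=> [[indB maxB]|[indB /eqP cardB]].
  have [J [BJ _ indJ <-]] := indep_extend indB (subsetT B).
  by rewrite (maxB J).
split=> // J indJ BJ; apply/esym/eqP.
by rewrite eqEcard BJ cardB leq_rank ?subsetT.
Qed.

Lemma basis_indep B : basis M B -> indep M B.
Proof. exact: maxsetp. Qed.

Lemma card_basis B : basis M B -> #|B| = rank [set: E].
Proof. by rewrite basisE => /andP[_ /eqP]. Qed.

Lemma rank_basis_sub B X : basis M B -> B \subset X -> rank X = rank [set: E].
Proof.
move=> bB BX; apply/eqP; rewrite eqn_leq rankS ?subsetT //=.
by rewrite -(card_basis bB) leq_rank ?basis_indep.
Qed.

Lemma rankU1_leq e X : rank (e |: X) <= (rank X).+1.
Proof.
apply: rank_leq => I IX indI; rewrite (cardsD1 e) -add1n leq_add ?leq_b1 //.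
by rewrite leq_rank ?subDset // (indepS (subD1set I e)).
Qed.

Lemma basis_extend B I : basis M B -> indep M I ->
  exists T, [/\ basis M T, I \subset T & T \subset I :|: B].
Proof.
move=> bB indI.
have [T [IT TIB indT cardT]] := indep_extend indI (subsetUl I B).
exists T; split=> //; rewrite basisE indT cardT.
by rewrite (rank_basis_sub bB (subsetUr I B)) eqxx.
Qed.

Lemma basis_exchange B S b : basis M B -> basis M S -> b \in B ->
  exists2 c, c \in S :\: (B :\ b) & basis M (c |: B :\ b).
Proof.
move=> bB bS bB'; have indBb := indepS (subD1set B b) (basis_indep bB).
have cardB : #|B| = #|B :\ b|.+1 by rewrite (cardsD1 b B) bB'.
have [|c cSB ind_c] := indep_aug indBb (basis_indep bS).
  by rewrite (card_basis bS) -(card_basis bB) cardB.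
exists c => //; rewrite basisE ind_c -(card_basis bB) cardB cardsU1.
by move: cSB; rewrite inE => /andP[-> _] /=.
Qed.

Definition mclosure X := [set e | rank (e |: X) == rank X].

Lemma rank_mclosure e X : rank (e |: X) + (e \in mclosure X) = (rank X).+1.
Proof.
have := rankS (subsetUr [set e] X); have := rankU1_leq e X.
by rewrite inE; case: eqVneq; lia.
Qed.

Lemma subset_mclosure X : X \subset mclosure X.
Proof. by apply/subsetP=> e eX; rewrite inE (setUidPr _) ?sub1set. Qed.

Lemma mclosure_exchange B X e : basis M B -> e \in B -> e \in mclosure X ->
  exists2 c, c \in X :\: (B :\ e) & basis M (c |: B :\ e).
Proof.
move=> bB eB; rewrite inE => /eqP rk_e.
have [eX|eX] := boolP (e \in X).
  by exists e; rewrite ?setD1K // !inE eqxx.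
have [I [_ IX indI cardI]] := indep_extend (indep0 M) (sub0set X).
have [S [bS IS SIB]] := basis_extend bB indI.
have eS : e \notin S.
  apply/negP=> eS; suff : #|e |: I| <= #|I|.
    by rewrite cardsU1 (contra (subsetP IX e) eX) ltnn.
  rewrite cardI -rk_e leq_rank ?setUS //.
  by rewrite (indepS _ (basis_indep bS)) // subUset sub1set eS.
have [c] := basis_exchange bB bS eB; rewrite inE => /andP[cBe cS] bc.
exists c => //; rewrite inE cBe; move: (subsetP SIB c cS).
rewrite inE => /orP[/(subsetP IX)//|cB].
by move: cBe; rewrite !inE cB andbT negbK => /eqP c_e; rewrite -c_e cS in eS.
Qed.

End Rank.

(* Minors keep the ambient type: deleted or contracted elements become loops. *)
Section Restriction.

Variables (E : finType) (M : matroid E) (S : {set E}).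
Implicit Types I J T X : {set E}.

Definition restrict_indep X := (X \subset S) && indep M X.

Fact restrict_indep0 : restrict_indep set0.
Proof. by rewrite /restrict_indep sub0set indep0. Qed.

Fact restrict_indepS I J : I \subset J -> restrict_indep J -> restrict_indep I.
Proof.
move=> IJ /andP[JS indJ]; rewrite /restrict_indep (subset_trans IJ) //.
exact: indepS indJ.
Qed.

Fact restrict_indep_aug I J : restrict_indep I -> restrict_indep J ->
  #|I| < #|J| -> exists2 e, e \in J :\: I & restrict_indep (e |: I).
Proof.
move=> /andP[IS indI] /andP[JS indJ] /(indep_aug indI indJ)[e eJI ind_eI].
exists e => //; rewrite /restrict_indep ind_eI subUset sub1set IS !andbT.
by move: eJI; rewrite inE => /andP[_]; exact: subsetP.
Qed.

Definition restrict : matroid E :=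
  Matroid restrict_indep0 restrict_indepS restrict_indep_aug.

Lemma rank_restrict X : rank restrict X = rank M (X :&: S).
Proof. by apply: eq_bigl => I; rewrite subsetI andbA. Qed.

Lemma basis_restrict T : rank M S = rank M [set: E] ->
  basis restrict T = (T \subset S) && basis M T.
Proof. by move=> spanS; rewrite !basisE rank_restrict setTI spanS andbA. Qed.

End Restriction.

Section Contraction.

Variables (E : finType) (M : matroid E) (P : {set E}) (indP : indep M P).
Implicit Types I J T X : {set E}.

Definition contract_indep X := [disjoint X & P] && indep M (X :|: P).

Fact contract_indep0 : contract_indep set0.
Proof. by rewrite /contract_indep set0U indP disjoints_subset sub0set. Qed.

Fact contract_indepS I J : I \subset J -> contract_indep J -> contract_indep I.
Proof.
move=> IJ /andP[dJP indJ]; rewrite /contract_indep (disjointWl IJ) //=.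
by apply: indepS indJ; exact: setSU.
Qed.

Fact contract_indep_aug I J : contract_indep I -> contract_indep J ->
  #|I| < #|J| -> exists2 e, e \in J :\: I & contract_indep (e |: I).
Proof.
move=> /andP[dIP indI] /andP[dJP indJ] ltIJ.
have [|e] := indep_aug indI indJ.
  by rewrite !cardsU_disjoint // ltn_add2r.
rewrite !inE negb_or => /andP[/andP[eI /negPf eP] eJ] ind_eI.
exists e; first by rewrite eP orbF in eJ; rewrite inE eI.
rewrite /contract_indep disjoints_subset subUset sub1set inE eP.
by rewrite -disjoints_subset dIP -setUA.
Qed.

Definition contract : matroid E :=
  Matroid contract_indep0 contract_indepS contract_indep_aug.

Lemma rank_contract X : rank contract X + #|P| = rank M (X :|: P).
Proof.
apply/eqP; rewrite eqn_leq; apply/andP; split.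
  have [I [_ IX /andP[dIP indIP] <-]] :=
    indep_extend (indep0 contract) (sub0set X).
  by rewrite -cardsU_disjoint // leq_rank // setSU.
have [J [PJ JXP indJ <-]] := indep_extend indP (subsetUr X P).
have dJP : [disjoint J :\: P & P].
  by rewrite disjoints_subset setDE subsetIr.
rewrite -{1}(setDUK PJ) cardsU_disjoint // leq_add2r; apply: leq_rank.
  by rewrite subDset setUC.
by rewrite /= /contract_indep setDUK ?dJP.
Qed.

Lemma basis_contract T :
  basis contract T = [disjoint T & P] && basis M (T :|: P).
Proof.
rewrite !basisE /= /contract_indep -andbA; apply: andb_id2l => dTP.
congr (_ && _); rewrite -[[set: E] in RHS](setTU P) -rank_contract.
by rewrite cardsU_disjoint // eqn_add2r.
Qed.

End Contraction.

Section ContractElement.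

Variables (E : finType) (M : matroid E) (e : E) (ind_e : indep M [set e]).
Implicit Types T X : {set E}.

Lemma basis_contract1 T :
  basis (contract ind_e) T = (e \notin T) && basis M (e |: T).
Proof. by rewrite basis_contract setUC disjoint_sym disjoints1. Qed.

Lemma rank_contract1 X :
  rank (contract ind_e) X + (e \in mclosure M X) = rank M X.
Proof.
by apply: succn_inj; rewrite -(rank_mclosure M e) -addSn -addn1 setUC
  -(rank_contract ind_e) cards1.
Qed.

End ContractElement.

Definition between (E : finType) (A B T : {set E}) :=
  (A :&: B \subset T) && (T \subset A :|: B).

Lemma between_sub (E : finType) (A B T : {set E}) :
  between A B T -> #|A :\: B| <= #|A :\: T| -> T \subset B.
Proof.
case/andP=> CT TAB le_diff; have eq_diff : A :\: T = A :\: B.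
  apply/eqP; rewrite eqEcard le_diff andbT.
  apply/subsetP=> x; rewrite !inE => /andP[xT xA]; rewrite xA andbT.
  by apply: contra xT => xB; apply: (subsetP CT); rewrite inE xA.
apply/subsetP=> x xT; have := subsetP TAB x xT; rewrite inE => /orP[xA|//].
by apply: contraT => xB; have /setP/(_ x) := eq_diff; rewrite !inE xA xB xT.
Qed.

Section IntervalMinor.

Variables (E : finType) (M : matroid E) (A B : {set E}) (bA : basis M A).
Implicit Types T : {set E}.

Fact indep_restrict_setI : indep (restrict M (A :|: B)) (A :&: B).
Proof.
rewrite /= /restrict_indep (subset_trans (subsetIl A B)) ?subsetUl //.
by rewrite (indepS _ (basis_indep bA)) ?subsetIl.
Qed.

Definition interval_minor := contract indep_restrict_setI.

Lemma basis_interval_minor T : basis interval_minor T =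
  [&& [disjoint T & A :&: B], between A B (T :|: (A :&: B))
    & basis M (T :|: (A :&: B))].
Proof.
rewrite basis_contract basis_restrict ?(rank_basis_sub bA) ?subsetUl //.
by rewrite /between subsetUr.
Qed.

Lemma basis_interval_minorD T :
  basis M T -> between A B T -> basis interval_minor (T :\: (A :&: B)).
Proof.
move=> bT ABT; rewrite basis_interval_minor setDUK; last by case/andP: ABT.
by rewrite ABT bT disjoints_subset setDE subsetIr.
Qed.

Lemma basis_interval_minorDl : basis interval_minor (A :\: (A :&: B)).
Proof.
by apply: basis_interval_minorD; rewrite // /between subsetIl subsetUl.
Qed.

Lemma basis_interval_minorDr :
  basis M B -> basis interval_minor (B :\: (A :&: B)).
Proof.
move=> bB; apply: basis_interval_minorD => //.
by rewrite /between subsetIr subsetUr.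
Qed.

End IntervalMinor.

Section Labels.

Variables (E : finType) (Gamma : zmodType) (psi : E -> Gamma).
Implicit Types (M : matroid E) (A B I T X Y : {set E}) (b c e : E) (g : Gamma).

Import GRing.Theory.

Lemma label_sumU X Y : [disjoint X & Y] ->
  label_sum psi (X :|: Y) = (label_sum psi X + label_sum psi Y)%R.
Proof.
by move=> dXY; rewrite /label_sum -bigU //; apply: eq_bigl => x; rewrite !inE.
Qed.

Lemma label_sumU1 e X :
  e \notin X -> label_sum psi (e |: X) = (psi e + label_sum psi X)%R.
Proof. exact: big_setU1. Qed.

Definition fiber g := [set e | psi e == g].

Definition element_labels : {fset Gamma} := [fset g in codom psi]%fset.

Lemma mem_element_labels e : psi e \in element_labels.
Proof. by rewrite inE codom_f. Qed.

Lemma sum_card_fiber X : \sum_(g <- element_labels) #|X :&: fiber g| = #|X|.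
Proof.
under eq_bigr => g _ do rewrite -sum1_card big_mkcond.
rewrite exchange_big -sum1_card [RHS]big_mkcond; apply: eq_bigr => e _.
rewrite (bigD1_seq (psi e)) ?mem_element_labels ?fset_uniq //=.
rewrite big1 ?addn0 => [|g].
  by rewrite !inE eqxx andbT.
by rewrite !inE eq_sym => /negPf->; rewrite andbF.
Qed.

Definition basis_labels M : {fset Gamma} :=
  [fset label_sum psi T | T in [set T | basis M T]]%fset.

Lemma basis_labelsP M g :
  reflect (exists2 T, basis M T & g = label_sum psi T) (g \in basis_labels M).
Proof.
apply: (iffP (imfsetP _ _ _ _)) => -[T bT ->]; exists T => //.
  by move: bT; rewrite inE.
by rewrite inE.
Qed.

Definition uniquely_labelled M B :=
  forall T, basis M T -> label_sum psi T = label_sum psi B -> T = B.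

Section ContractedLabels.

Variables (M : matroid E) (e : E) (ind_e : indep M [set e]).

Let M_e := contract ind_e.

Lemma uniquely_labelled_contract B : e \in B ->
  uniquely_labelled M B -> uniquely_labelled M_e (B :\ e).
Proof.
move=> eB uniqB T; rewrite basis_contract1 => /andP[eT beT] eq_lab.
rewrite -(uniqB (e |: T) beT) ?setU1K // label_sumU1 // eq_lab.
by rewrite -label_sumU1 ?setD1K // !inE eqxx.
Qed.

Definition spanning_labels : {fset Gamma} :=
  [fset g in element_labels | e \in mclosure M (fiber g)]%fset.

Lemma in_spanning_labels g :
  (g \in spanning_labels) =
    (g \in element_labels) && (e \in mclosure M (fiber g)).
Proof. by rewrite !inE. Qed.

Lemma spanning_labels_exchange g T : g \in spanning_labels -> basis M_e T ->
  exists2 c, psi c = g & c \notin T /\ basis M (c |: T).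
Proof.
rewrite in_spanning_labels basis_contract1 => /andP[_ e_cl] /andP[eT beT].
have [c] := mclosure_exchange beT (setU11 e T) e_cl.
by rewrite setU1K // !inE => /andP[cT /eqP psi_c] bcT; exists c.
Qed.

Lemma card_basis_labels_contract B : e \in B -> basis M B ->
    uniquely_labelled M B ->
  #|` basis_labels M_e| + #|` spanning_labels| <= #|` basis_labels M|.+1.
Proof.
move=> eB bB uniqB; have eBe : e \notin B :\ e by rewrite !inE eqxx.
apply: leq_trans (_ : #|` sumset (basis_labels M_e) spanning_labels|.+1 <= _).
  apply: (@Scherk_card_sumset _ _ _ (label_sum psi (B :\ e)) (psi e)).
  - apply/basis_labelsP; exists (B :\ e) => //.
    by rewrite basis_contract1 eBe setD1K.
  - rewrite in_spanning_labels mem_element_labels.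
    by apply: (subsetP (subset_mclosure _ _)); rewrite inE.
  move=> _ g /basis_labelsP[T bT ->] g_e.
  have [c <- [cT bcT]] := spanning_labels_exchange g_e bT.
  rewrite addrC [RHS]addrC -!label_sumU1 // setD1K // => /(uniqB _ bcT) defB.
  by move: eB bT; rewrite basis_contract1 -defB !inE => /orP[/eqP-> //|->].
rewrite ltnS; apply/fsubset_leq_card/fsubsetP=> z /sumsetP[x].
case/basis_labelsP=> T bT -> [g g_e ->].
have [c <- [cT bcT]] := spanning_labels_exchange g_e bT.
by apply/basis_labelsP; exists (c |: T); rewrite // label_sumU1 // addrC.
Qed.

End ContractedLabels.

(* Schrijver and Seymour's lower bound on the number of labels, for a uniquely
   labelled basis and rearranged so that no subtraction occurs. *)
Lemma sum_rank_fiber_ltn M B : basis M B -> uniquely_labelled M B ->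
  \sum_(g <- element_labels) rank M (fiber g) < #|` basis_labels M| + #|B|.
Proof.
have [n] := ubnP #|B|; elim: n => // n IHn in M B *.
rewrite ltnS => leBn bB uniqB; have [B0|[e eB]] := set_0Vmem B.
  rewrite big1 => [|g _].
    rewrite addn_gt0 cardfs_gt0; apply/orP; left; apply/fset0Pn.
    by exists (label_sum psi B); apply/basis_labelsP; exists B.
  by apply/eqP; rewrite -leqn0 -(cards0 E) -B0 (card_basis bB) rankS ?subsetT.
have ind_e : indep M [set e].
  by apply: indepS (basis_indep bB); rewrite sub1set.
have bBe : basis (contract ind_e) (B :\ e).
  by rewrite basis_contract1 setD1K // !inE eqxx.
have := card_basis_labels_contract ind_e eB bB uniqB.
have := IHn _ _ _ bBe (uniquely_labelled_contract eB uniqB).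
have -> : #|` spanning_labels M e| =
    \sum_(g <- element_labels) (e \in mclosure M (fiber g)).
  by rewrite card_fset_sum1 -big_fset_condE big_mkcond.
rewrite (cardsD1 e B) eB add1n in leBn *.
under [X in _ -> _ -> X < _]eq_bigr do rewrite -(rank_contract1 ind_e).
rewrite big_split /= => /(_ leBn); lia.
Qed.

Lemma uniquely_labelled_exchange M B b c : basis M B ->
    uniquely_labelled M B -> b \in B -> c \notin B -> psi c = psi b ->
  ~~ basis M (c |: B :\ b).
Proof.
move=> bB uniqB bB' cB psi_c; apply: contra (cB) => bc.
suff <- : c |: B :\ b = B by rewrite setU11.
apply: uniqB => //; have cBb : c \notin B :\ b by rewrite inE negb_and cB orbT.
by rewrite label_sumU1 // psi_c -label_sumU1 ?setD11 ?setD1K.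
Qed.

Lemma indep_fiber M B I g : basis M B -> uniquely_labelled M B -> indep M I ->
  indep M ((I :|: B) :&: fiber g).
Proof.
move=> bB uniqB indI.
have indIg : indep M (I :&: fiber g) by apply: indepS indI; exact: subsetIl.
have [T [bT IT TIB]] := basis_extend bB indIg.
apply: indepS (basis_indep bT); rewrite setIUl subUset IT.
apply/subsetP=> b; rewrite !inE => /andP[bB' /eqP psi_b]; apply: contraT => bT'.
have [c] := basis_exchange bB bT bB'.
rewrite !inE negb_and negbK => /andP[cBb cT] bc.
have cB : c \notin B by case/predU1P: cBb => // c_b; rewrite -c_b cT in bT'.
have psi_c : psi c = psi b.
  move: (subsetP TIB c cT); rewrite !inE (negPf cB) orbF psi_b.
  by case/andP=> _ /eqP.
by case/negP: (uniquely_labelled_exchange bB uniqB bB' cB psi_c).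
Qed.

Lemma card_basis_labels M B I : basis M B -> uniquely_labelled M B ->
  indep M I -> #|I :\: B| < #|` basis_labels M|.
Proof.
move=> bB uniqB indI; rewrite -(ltn_add2r #|B|).
apply: leq_ltn_trans (sum_rank_fiber_ltn bB uniqB).
have -> : #|I :\: B| + #|B| = #|I :|: B|.
  by have := cardsUI I B; have := cardsID B I; lia.
rewrite -(sum_card_fiber (I :|: B)); apply: leq_sum => g _.
by rewrite leq_rank ?subsetIr ?indep_fiber.
Qed.

Section AvoidingInterval.

Variables (M : matroid E) (F : {fset Gamma}) (A B : {set E}).
Hypotheses (bA : basis M A) (bB : basis M B) (avB : avoiding psi F B).
Hypothesis avoiding_between : forall T,
  basis M T -> between A B T -> avoiding psi F T -> T = B.

Let C := A :&: B.
Let N := interval_minor B bA.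

Lemma label_interval_minor T : basis N T ->
  label_sum psi (T :|: C) = (label_sum psi T + label_sum psi C)%R.
Proof.
by rewrite basis_interval_minor => /and3P[dTC _ _]; exact: label_sumU.
Qed.

Lemma avoiding_interval_minor T :
  basis N T -> avoiding psi F (T :|: C) -> T = B :\: C.
Proof.
rewrite basis_interval_minor => /and3P[dTC ABT bT] avT.
by rewrite -(avoiding_between bT ABT avT) setDUl setDv setU0 (setDidPl dTC).
Qed.

Lemma uniquely_labelled_interval_minor : uniquely_labelled N (B :\: C).
Proof.
move=> T bT eq_lab; apply: avoiding_interval_minor => //.
rewrite /avoiding label_interval_minor // eq_lab.
rewrite -(label_interval_minor (basis_interval_minorDr bA bB)).
by rewrite setDUK ?subsetIr.
Qed.

Lemma basis_labels_interval_minor_sub : (basis_labels N `<=`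
  translate (- label_sum psi C)%R (label_sum psi B |` F))%fset.
Proof.
apply/fsubsetP=> _ /basis_labelsP[T bT ->].
apply/translateP; exists (label_sum psi (T :|: C)); last first.
  by rewrite label_interval_minor // addrC addrK.
have [avT|] := boolP (avoiding psi F (T :|: C)).
  by rewrite (avoiding_interval_minor bT avT) setDUK ?subsetIr // !inE eqxx.
by rewrite /avoiding negbK !inE => ->; rewrite orbT.
Qed.

Lemma card_diff_avoiding_leq : #|A :\: B| <= #|` F|.
Proof.
have -> : A :\: B = (A :\: C) :\: (B :\: C).
  by apply/setP=> x; rewrite !inE; case: (x \in A); case: (x \in B).
rewrite -ltnS; apply: leq_trans (_ : #|` basis_labels N| <= _).
  apply: card_basis_labels (basis_interval_minorDr bA bB) _ _.
    exact: uniquely_labelled_interval_minor.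
  exact: basis_indep (basis_interval_minorDl B bA).
apply: leq_trans (fsubset_leq_card basis_labels_interval_minor_sub) _.
by rewrite card_translate cardfsU1 [_ \notin F]avB.
Qed.

End AvoidingInterval.

Lemma exists_avoiding_basis_near M (F : {fset Gamma}) A : basis M A ->
    (exists B, basis M B /\ avoiding psi F B) ->
  exists B, [/\ basis M B, avoiding psi F B & #|A :\: B| <= #|` F| ].
Proof.
move=> bA [B0 [bB0 avB0]].
have [|B /andP[bB avB] minB] :=
    @arg_minnP _ B0 (fun B => basis M B && avoiding psi F B)
      (fun B => #|A :\: B|).
  by rewrite bB0.
exists B; split=> //; apply: (card_diff_avoiding_leq bA bB avB) => T bT ABT avT.
apply/eqP; rewrite eqEcard (card_basis bT) (card_basis bB) leqnn andbT.
by apply: between_sub ABT _; rewrite minB ?bT.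
Qed.

End Labels.

Theorem theorem4p4 (E : finType) (M : matroid E) (Gamma : zmodType)
  (psi : E -> Gamma) (F : {fset Gamma}) (hF : #|` F| <= 4)
  (hex : exists B : {set E}, basis M B /\ avoiding psi F B) :
  forall A : {set E}, basis M A ->
    exists B : {set E},
      [/\ basis M B, avoiding psi F B & #|A :\: B| <= #|` F| ].
Proof. by move=> A bA; exact: exists_avoiding_basis_near. Qed.
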